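(* For an instance $I$ of $P|\mathrm{prec},\mathrm{pmtn},p_j=1|C_{\max}$ with jobs $J_1,\dots,J_n$, $m$ machines and precedence relation $\prec$, and an integer $T\ge1$, let $\mathrm{LP}(I,T)$ be the linear feasibility system in variables $x_{j,t}$ ($1\le j\le n$, $1\le t\le T$): $\sum_{j=1}^n x_{j,t}\le m$ for all $t\in\{1,\dots,T\}$; $\sum_{t=1}^T x_{j,t}=1$ for all $j$; $\sum_{t=1}^{t'-1}x_{\ell,t}+\sum_{t=t'+1}^{T}x_{k,t}\ge 1$ for all pairs $J_\ell\prec J_k$ and all $t'\in\{1,\dots,T\}$; $x_{j,t}\ge0$. Let $T_{LP}(I)$ be the smallest integer $T$ for which $\mathrm{LP}(I,T)$ is feasible and $\mathrm{OPT}(I)$ the optimal makespan of $I$. Then the integrality gap $\sup_I \mathrm{OPT}(I)/T_{LP}(I)$ of this LP, over all instances $I$, equals $2$.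
   Context: $P|\mathrm{prec},\mathrm{pmtn},p_j=1|C_{\max}$: given $n$ unit-processing-time jobs with precedence constraints (if $J\prec J'$ then $J'$ cannot start before $J$ completes) and $m$ identical parallel machines, find a feasible preemptive schedule (a job may be interrupted and resumed later, possibly on another machine; each machine processes at most one job at a time and each job runs on at most one machine at a time) minimising the makespan. The variable $x_{j,t}$ is intended as the fraction of job $J_j$ processed between time $t-1$ and $t$. *)

(* Defs.v *)
From HB Require Import structures.
From mathcomp Require Import all_boot all_order all_algebra.
From mathcomp Require Import zify.
From mathcomp Require Import boolp classical_sets reals ereal.

Set Implicit Arguments.
Unset Strict Implicit.
Unset Printing Implicit Defensive.

Import Order.TTheory GRing.Theory Num.Theory.

Local Open Scope ring_scope.

(* J_1, ..., J_n are indexed by 'I_n; [prec] is the full (transitively        *)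
(* closed) strict partial order on the jobs.                                  *)
Record instance := Instance {
  njobs : nat;
  nmach : nat;
  prec : rel 'I_njobs;
  nmach_gt0 : (0 < nmach)%N;
  prec_irr : irreflexive prec;
  prec_trans : transitive prec }.

Section Schedule.
Variables (R : realType) (I : instance).

(* A preemptive schedule is a finite family of pieces: piece i is the         *)
(* uninterrupted execution of job [pjob i] on machine [pmach i] during the    *)
(* time interval from [pstart i] to [pend i].                                 *)
Record schedule := Schedule {
  npieces : nat;
  pjob : 'I_npieces -> 'I_(njobs I);
  pmach : 'I_npieces -> 'I_(nmach I);
  pstart : 'I_npieces -> R;
  pend : 'I_npieces -> R }.

Definition nonoverlap (s : schedule) (i i' : 'I_(npieces s)) : bool :=
  (pend i <= pstart i') || (pend i' <= pstart i).

Definition feasible (s : schedule) : Prop :=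
  [/\ forall i : 'I_(npieces s), 0 <= pstart i < pend i,
      forall i i' : 'I_(npieces s),
        i != i' -> pmach i = pmach i' -> nonoverlap i i',
      forall i i' : 'I_(npieces s),
        i != i' -> pjob i = pjob i' -> nonoverlap i i',
      forall j, \sum_(i < npieces s | pjob i == j) (pend i - pstart i) = 1 &
      forall i i' : 'I_(npieces s),
        prec (pjob i) (pjob i') -> pend i <= pstart i'].

Definition makespan (s : schedule) : R :=
  \big[Num.max/0]_(i < npieces s) pend i.

(* The set below is nonempty (feasible_exists) and bounded below by 0.        *)
Definition OPT : R := inf [set makespan s | s in feasible].

(* Only the values [x j t] with 1 <= t <= T are used.                         *)
Definition LP (T : nat) (x : 'I_(njobs I) -> nat -> R) : Prop :=
  [/\ forall t, (1 <= t <= T)%N -> \sum_j x j t <= (nmach I)%:R,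
      forall j, \sum_(1 <= t < T.+1) x j t = 1,
      forall l k, prec l k -> forall t', (1 <= t' <= T)%N ->
        \sum_(1 <= t < t') x l t + \sum_(t'.+1 <= t < T.+1) x k t >= 1 &
      forall j t, (1 <= t <= T)%N -> 0 <= x j t].

Definition LP_feasible (T : nat) : Prop := exists x, LP T x.

(* One job per unit slot, by increasing number of predecessors: this solves   *)
(* LP T for some T, so the least such T exists, and is a feasible schedule.   *)
Let depth (j : 'I_(njobs I)) := #|[pred k | prec k j]|.
Let slot (j : 'I_(njobs I)) := (depth j * njobs I + j).+1.

Let depth_lt l k : prec l k -> (depth l < depth k)%N.
Proof.
move=> lk; apply: proper_card; apply/fintype.properP; split.
  by apply/fintype.subsetP => i; rewrite !inE => il; exact: prec_trans il lk.
by exists l; rewrite !inE ?lk ?prec_irr.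
Qed.

Let depth_max j : (depth j < njobs I)%N.
Proof.
rewrite -[X in (_ < X)%N]card_ord; apply: proper_card.
by apply/fintype.properP; split; [exact/fintype.subsetP | exists j; rewrite !inE ?prec_irr].
Qed.

Let slot_inj : injective slot.
Proof.
move=> i j [] /(congr1 (modn^~ (njobs I))) /=.
by rewrite !modnMDl !modn_small // => /val_inj.
Qed.

Let slot_lt l k : prec l k -> (slot l < slot k)%N.
Proof.
move=> /depth_lt lk; have := ltn_ord l; rewrite /slot.
have : ((depth l).+1 * njobs I <= depth k * njobs I)%N by rewrite leq_mul2r lk orbT.
by rewrite mulSn; lia.
Qed.

Let slot_max j : (slot j <= (njobs I * njobs I).+1)%N.
Proof.
have : ((depth j).+1 * njobs I <= njobs I * njobs I)%N by rewrite leq_mul2r depth_max orbT.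
by have := ltn_ord j; rewrite mulSn /slot; lia.
Qed.

Let sum_slot j a b :
  \sum_(a <= t < b) (t == slot j)%:R = (a <= slot j < b)%N%:R :> R.
Proof.
rewrite (eq_bigr (fun t => if t == slot j then 1 else 0 : R)); last first.
  by move=> t _; case: eqP.
by rewrite -big_mkcond big_nat1_eq; case: ifP.
Qed.

Lemma LP_feasible_exists : exists T, (0 < T)%N && `[< LP_feasible T >].
Proof.
exists (njobs I * njobs I).+1 => /=; apply/asboolP.
exists (fun j t => (t == slot j)%:R); split.
- move=> t _; apply: (@le_trans _ _ 1); last by rewrite ler1n nmach_gt0.
  have [/existsP[j /eqP ->]|/existsPn h] := boolP [exists j, t == slot j].
    rewrite (bigD1 j) //= eqxx big1 ?addr0 // => i ij.
    by rewrite (inj_eq slot_inj) eq_sym (negbTE ij).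
  by rewrite big1 // => i _; rewrite (negbTE (h i)).
- by move=> j; rewrite sum_slot ltnS slot_max.
- move=> l k /slot_lt lk t' _; rewrite !sum_slot -natrD ler1n.
  rewrite [(slot k < _)%N]ltnS slot_max andbT /=.
  by case: (ltnP (slot l) t') => //= /leq_ltn_trans ->.
- by move=> j t _; exact: ler0n.
Qed.

Lemma feasible_exists : exists s, feasible s.
Proof.
exists (Schedule id (fun=> Ordinal (nmach_gt0 I))
  (fun j => (slot j)%:R) (fun j => (slot j).+1%:R)).
have nov i i' : i != i' -> (slot i < slot i')%N || (slot i' < slot i)%N.
  by move=> ii'; rewrite -neq_ltn (inj_eq slot_inj).
split=> [i|i i' /nov ii' _|i i' /nov ii' _|j|i i' /slot_lt ii'] /=.
- by rewrite ler0n ltr_nat /=.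
- by rewrite /nonoverlap /= !ler_nat.
- by rewrite /nonoverlap /= !ler_nat.
- by rewrite big_pred1_eq -natrB // subSnn.
- by rewrite ler_nat.
Qed.

Definition T_LP : nat := ex_minn LP_feasible_exists.

End Schedule.

(* Main.v *)
(* Upper bound: for an LP solution x, let the level of a job be the first time
   step t with x_{j,t} > 0. The LP precedence constraints make levels increase
   strictly along the precedence order, and the capacity constraints give
   n <= m T. Scheduling level after level uses at most n / m + T <= 2 T slots.

   Lower bound: take m = p machines and p groups, each made of p layers with one
   job followed by a layer with p^2 jobs, every layer preceding the next one. A
   schedule needs time p + p per group, 2 p^2 in total. The LP overlaps p + 1
   consecutive layers by spreading each job over p + 1 time steps, and so
   succeeds with T = p (p + 1) + p = p (p + 2). The ratio 2 p / (p + 2) tends to 2. *)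

Require Import Defs.
From HB Require Import structures.
From mathcomp Require Import all_boot all_order all_algebra.
From mathcomp Require Import boolp classical_sets reals ereal.
From mathcomp Require Import zify lra.

Import Order.TTheory GRing.Theory Num.Theory.
Local Open Scope ring_scope.

Set Implicit Arguments.
Unset Strict Implicit.
Unset Printing Implicit Defensive.

(** * Length and volume bounds for preemptive schedules *)

(** Induction on the number of intervals: remove one with the latest end. Every other interval must
    end before it starts, so the rest fits between [A] and its start. *)
Lemma sum_disjoint_intervals (R : realType) (T : finType) (st en : T -> R)
    (A B : R) (P : pred T) :
  (forall i, P i -> [/\ A <= st i, st i < en i & en i <= B]) ->
  (forall i j, P i -> P j -> i != j -> (en i <= st j) || (en j <= st i)) ->
  A <= B -> \sum_(i | P i) (en i - st i) <= B - A.
Proof.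
elim: {P}#|P| {-2}P (erefl #|P|) B => [|n IH] P cardP B inAB disj AB.
  by rewrite big_pred0 ?subr_ge0// => i; exact: card0_eq cardP i.
have [i0 Pi0] : exists i, P i by apply/card_gt0P; rewrite cardP.
have [i Pi imax] := Order.TotalTheory.arg_maxP en Pi0.
have [Ai sei eiB] := inAB i Pi.
rewrite (bigD1 i)//=.
suff : \sum_(j | P j && (j != i)) (en j - st j) <= st i - A by lra.
apply: IH => //.
- by apply: succn_inj; rewrite -cardP (cardD1 i P) unfold_in Pi add1n; congr _.+1;
    apply: eq_card => j; rewrite !inE andbC.
- move=> j /andP[Pj ji]; have [Aj sej _] := inAB j Pj; split => //.
  have /orP[//|ij] := disj j i Pj Pi ji.
  by have /= := imax j Pj; rewrite leNgt (le_lt_trans ij sej).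
- by move=> j k /andP[Pj _] /andP[Pk _]; exact: disj.
Qed.

Section FeasibleSchedule.
Context {R : realType} {I : instance} {s : schedule R I}.
Hypothesis fs : feasible s.

Lemma makespan_ge0 : 0 <= makespan s.
Proof. exact: bigmax_ge_id. Qed.

Lemma pend_le_makespan (i : 'I_(npieces s)) : pend i <= makespan s.
Proof. exact: le_bigmax. Qed.

Lemma job_length_le (j : 'I_(njobs I)) (A B : R) :
  (forall i : 'I_(npieces s), pjob i = j -> A <= pstart i /\ pend i <= B) ->
  1 <= B - A.
Proof.
move=> inAB; have [st _ disj len _] := fs; rewrite -(len j).
apply: sum_disjoint_intervals.
- by move=> i /eqP /inAB[? ?]; have /andP[_ ?] := st i.
- by move=> i k /eqP ij /eqP kj ik; apply: disj => //; rewrite ij kj.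
(* The window is nonempty because a job of total length 1 has at least one piece. *)
case: (pickP (fun i : 'I_(npieces s) => pjob i == j)) => [i /eqP /inAB[Ai iB]|none].
  by have /andP[_ /ltW sei] := st i; exact: le_trans Ai (le_trans sei iB).
by have := len j; rewrite big_pred0// => /eqP; rewrite eq_sym oner_eq0.
Qed.

(** The total work, counted job by job, is regrouped by machine; each machine contributes disjoint
    intervals inside the window. *)
Lemma volume_le (P : pred 'I_(njobs I)) (A B : R) :
  (forall i : 'I_(npieces s), P (pjob i) -> A <= pstart i /\ pend i <= B) ->
  A <= B -> #|P|%:R <= (nmach I)%:R * (B - A).
Proof.
move=> inAB AB; have [st disj _ len _] := fs.
have -> : #|P|%:R = \sum_(i < npieces s | P (pjob i)) (pend i - pstart i).
  rewrite (partition_big (@pjob _ _ s) P)//= -sum1_card natr_sum.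
  apply: eq_bigr => j Pj; rewrite -(len j); apply: eq_bigl => i.
  by case: eqP => [->|]; rewrite ?andbT ?andbF.
rewrite (partition_big (@pmach _ _ s) predT)//=.
apply: (@le_trans _ _ (\sum_(k < nmach I) (B - A))); last first.
  by rewrite sumr_const card_ord mulr_natl.
apply: ler_sum => k _; apply: sum_disjoint_intervals => //.
- by move=> i /andP[/inAB[? ?] _]; have /andP[_ ?] := st i.
- by move=> i l /andP[_ /eqP ik] /andP[_ /eqP lk] il; apply: disj => //; rewrite ik lk.
Qed.

End FeasibleSchedule.

(** * Bounding the optimum through schedules *)

Lemma OPT_ge (R : realType) (I : instance) (a : R) :
  (forall s : schedule R I, feasible s -> a <= makespan s) -> a <= OPT R I.
Proof.
move=> lb; apply: lb_le_inf; last by move=> _ [s fs <-]; exact: lb.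
by have [s fs] := feasible_exists R I; exists (makespan s), s.
Qed.

Lemma OPT_le (R : realType) (I : instance) (s : schedule R I) :
  feasible s -> OPT R I <= makespan s.
Proof.
move=> fs; apply: ge_inf; last by exists s.
by exists 0 => _ [r _ <-]; exact: makespan_ge0.
Qed.

Lemma OPT_le_slots (R : realType) (I : instance)
    (slot : 'I_(njobs I) -> nat) (mach : 'I_(njobs I) -> 'I_(nmach I)) (K : nat) :
  (forall i j, slot i = slot j -> mach i = mach j -> i = j) ->
  (forall i j, prec i j -> (slot i < slot j)%N) ->
  (forall j, (slot j < K)%N) ->
  OPT R I <= K%:R.
Proof.
move=> inj mono ltK.
pose s := @Schedule R I (njobs I) id mach
  (fun j => (slot j)%:R) (fun j => (slot j).+1%:R).
have fs : feasible s.
  split=> [i|i i' ii' mm|i i' ii' eqii'|j|i i' /mono ii'] /=.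
  - by rewrite ler0n ltr_nat /=.
  - rewrite /nonoverlap /= !ler_nat -neq_ltn; apply: contraNneq ii' => eqs.
    by rewrite (inj i i').
  - by rewrite /= in eqii'; rewrite eqii' eqxx in ii'.
  - by rewrite big_pred1_eq -natrB // subSnn.
  - by rewrite ler_nat.
apply: le_trans (OPT_le fs) _.
by apply: bigmax_le => [|i _]; rewrite ?ler0n// ler_nat.
Qed.

(** * Upper bound: the gap is at most 2 *)

(** Levels are scheduled one after another, each filling its slots machine by machine. A level with
    [size e] jobs gets [size e %/ m + 1] slots, and [m] times this is at most [size e + m]; summing
    over the levels gives the bound. *)
Lemma OPT_le_levels (R : realType) (I : instance) (lev : 'I_(njobs I) -> nat)
    (T : nat) :
  (forall i j, prec i j -> (lev i < lev j)%N) ->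
  (forall j, (lev j < T)%N) ->
  (nmach I)%:R * OPT R I <= (njobs I + nmach I * T)%:R :> R.
Proof.
move=> mono ltT; have m0 := nmach_gt0 I; set m := nmach I in m0 *.
pose size e := #|[pred i | lev i == e]|.
pose width e := (size e %/ m).+1.
(* Position of [j] inside its level: the quotient by [m] chooses the slot, the remainder the
   machine. *)
pose rank j := #|[pred i : 'I_(njobs I) | (lev i == lev j) && (i < j)%N]|.
pose slot j := (\sum_(0 <= e < lev j) width e + rank j %/ m)%N.
pose mach j := Ordinal (ltn_pmod (rank j) m0).
have rank_lt i j : lev i = lev j -> (i < j)%N -> (rank i < rank j)%N.
  move=> lij ij; apply: proper_card; apply/fintype.properP; split.
    apply/fintype.subsetP => k; rewrite !inE lij => /andP[-> ki].
    exact: ltn_trans ki ij.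
  by exists i; rewrite !inE ?lij ?eqxx ?ltnn ?ij.
have rank_size j : (rank j <= size (lev j))%N.
  by apply: subset_leq_card; apply/fintype.subsetP => k; rewrite !inE => /andP[].
have slot_lt j e : (lev j < e)%N -> (slot j < \sum_(0 <= e' < e) width e')%N.
  move=> je; rewrite (big_cat_nat (n := (lev j).+1))//= big_nat_recr//=.
  by rewrite ltn_addr// ltn_add2l ltnS leq_div2r.
have slot_lev i j : (lev i < lev j)%N -> (slot i < slot j)%N.
  by move=> /slot_lt /leq_trans; apply; exact: leq_addr.
have le_slots : OPT R I <= (\sum_(0 <= e < T) width e)%:R.
  apply: (@OPT_le_slots R I slot mach) => [i j sij [mij]|i j /mono|j].
  - have lij : lev i = lev j.
      by have [/slot_lev|/slot_lev|//] := ltngtP (lev i) (lev j); rewrite sij ltnn.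
    have rij : rank i = rank j.
      move: sij; rewrite /slot lij => /addnI dij.
      by rewrite (divn_eq (rank i) m) (divn_eq (rank j) m) dij mij.
    have [/rank_lt|/rank_lt|/val_inj//] := ltngtP i j; rewrite ?lij rij ltnn.
      by move=> /(_ erefl).
    by move=> /(_ erefl).
  - exact: slot_lev.
  - exact: slot_lt.
apply: (@le_trans _ _ (m * \sum_(0 <= e < T) width e)%:R).
  by rewrite natrM ler_wpM2l.
rewrite ler_nat /width big_mkord.
under eq_bigr do rewrite -addn1.
rewrite big_split/= sum1_card card_ord mulnDr leq_add2r big_distrr/=.
apply: (@leq_trans (\sum_(e < T) size e)).
  by apply: leq_sum => e _; rewrite mulnC leq_trunc_div.
rewrite -[X in (_ <= X)%N]card_ord -sum1_card.
rewrite (partition_big (fun j => Ordinal (ltT j)) predT)//=.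
apply: leq_sum => e _; rewrite /size -sum1_card; apply: eq_leq.
by apply: eq_bigl => j; rewrite !inE -val_eqE.
Qed.

Lemma LP_volume (R : realType) (I : instance) (T : nat)
    (x : 'I_(njobs I) -> nat -> R) :
  LP T x -> (njobs I <= nmach I * T)%N.
Proof.
move=> [cap tot _ _]; rewrite -(ler_nat R) natrM.
have -> : (njobs I)%:R = \sum_(j < njobs I) \sum_(1 <= t < T.+1) x j t.
  by under eq_bigr do rewrite tot; rewrite sumr_const card_ord.
rewrite exchange_big/=.
apply: (@le_trans _ _ (\sum_(1 <= t < T.+1) (nmach I)%:R)).
  by apply: ler_sum_nat => t tT; apply: cap.
by rewrite sumr_const_nat subSS subn0 mulr_natr.
Qed.

(* The level of a job is the first time step in which the LP solution
   processes it; the precedence constraint of the LP forces it to increase. *)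
Lemma LP_levels (R : realType) (I : instance) (T : nat)
    (x : 'I_(njobs I) -> nat -> R) :
  LP T x -> exists2 lev : 'I_(njobs I) -> nat,
    forall i j, prec i j -> (lev i < lev j)%N & forall j, (lev j < T)%N.
Proof.
move=> [_ tot pr ge0].
have ex j : exists t, [&& (t < T)%N & 0 < x j t.+1].
  apply/not_existsP => none.
  have := tot j; rewrite big_nat big1 => [/eqP|t tT]; first by rewrite eq_sym oner_eq0.
  apply/eqP; apply: contra_notT (none t.-1) => xt.
  by case: t xt tT => // t xt tT; rewrite /= lt0r xt ge0// andbT; lia.
exists (fun j => ex_minn (ex j)) => [l k lk|j]; last by case: ex_minnP => t /andP[].
case: ex_minnP => a /andP[aT xa] mina; case: ex_minnP => b /andP[bT xb] _.
rewrite ltnNge; apply/negP => ba.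
(* Level [b] stands for time step [b.+1]. With [t' = b.+1] and [b <= a], the sum for [l] vanishes,
   while the sum for [k] misses the positive term at [b.+1] and stays below 1. *)
have := pr l k lk b.+1; rewrite bT => /(_ isT).
rewrite big_nat big1 => [|t tb]; last first.
  apply/eqP; apply: contraTT ba => xt; rewrite -ltnNge.
  case: t xt tb => // t xt tb.
  suff : (a <= t)%N by lia.
  apply: mina; rewrite lt0r xt ge0 ?andbT; lia.
rewrite add0r leNgt -(tot k) => /negP[].
rewrite [ltRHS](big_cat_nat (n := b.+2))//= ltrDr big_nat_recr//=.
rewrite ltr_wpDl// big_nat sumr_ge0// => t tb; apply: ge0; lia.
Qed.

Lemma T_LP_gt0 (R : realType) (I : instance) : (0 < T_LP R I)%N.
Proof. by rewrite /T_LP; case: ex_minnP => T /andP[]. Qed.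

(** With [n] jobs and [m] machines, [m * OPT <= n + m * T <= 2 * m * T]. *)
Lemma OPT_le_2T_LP (R : realType) (I : instance) :
  OPT R I <= 2 * (T_LP R I)%:R.
Proof.
rewrite /T_LP; case: ex_minnP => T /andP[T0 /asboolP[x LPx]] _.
have [lev mono ltT] := LP_levels LPx.
have m0 : 0 < (nmach I)%:R :> R by rewrite ltr0n nmach_gt0.
rewrite -(ler_pM2l m0); apply: le_trans (OPT_le_levels R mono ltT) _.
by rewrite -!natrM ler_nat; have := LP_volume LPx; lia.
Qed.

(** * Lower bounds on schedules of layered instances *)

Section LayeredInstance.
Context {R : realType} {I : instance} {s : schedule R I}.
Hypothesis fs : feasible s.
Variable lev : 'I_(njobs I) -> nat.
Hypothesis lev_prec : forall i j, (lev i < lev j)%N -> prec i j.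

(** A lower bound [a] on the time when all layers below [k] are finished, phrased through upper
    bounds [B] to avoid a maximum over pieces. The condition [0 <= B] serves [k = 0], where no piece
    constrains [B]. *)
Definition layers_need (k : nat) (a : R) : Prop :=
  forall B, 0 <= B ->
    (forall i : 'I_(npieces s), (lev (pjob i) < k)%N -> pend i <= B) -> a <= B.

Lemma layers_need_pstart (k : nat) (a : R) (i : 'I_(npieces s)) :
  layers_need k a -> lev (pjob i) = k -> a <= pstart i.
Proof.
move=> need lik; have [st _ _ _ pr] := fs; apply: need.
  by have /andP[] := st i.
by move=> i' i'k; apply/pr/lev_prec; rewrite lik.
Qed.

Lemma layers_need_job (k : nat) (a : R) (j : 'I_(njobs I)) :
  lev j = k -> layers_need k a -> layers_need k.+1 (a + 1).
Proof.
move=> jk need B B0 leB; rewrite -lerBrDl.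
apply: (job_length_le fs (j := j)) => i ij; split.
  by apply: layers_need_pstart need _; rewrite ij.
by apply: leB; rewrite ij jk.
Qed.

Lemma layers_need_volume (k d : nat) (a : R) :
  (nmach I * d <= #|[pred j | lev j == k]|)%N ->
  layers_need k a -> layers_need k.+1 (a + d%:R).
Proof.
move=> vol need B B0 leB; rewrite -lerBrDl.
have m0 : 0 < (nmach I)%:R :> R by rewrite ltr0n nmach_gt0.
rewrite -(ler_pM2l m0) -natrM.
apply: le_trans (volume_le fs (P := [pred j | lev j == k]) (A := a) (B := B) _ _).
- by rewrite ler_nat.
- move=> i /eqP ik; split; first exact: layers_need_pstart need ik.
  by apply: leB; rewrite ik.
- by apply: need => // i ik; apply: leB; exact: ltnW.
Qed.

End LayeredInstance.

(** * Lower bound: instances with gap tending to 2 *)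

Lemma sum_nat_window (R : realType) (c : R) (l w a b : nat) :
  \sum_(a <= t < b) (if (l < t <= l + w)%N then c else 0) =
  c *+ (minn b (l + w).+1 - maxn a l.+1).
Proof.
elim: b => [|b IH]; first by rewrite big_geq// min0n sub0n mulr0n.
have [ab|ba] := leqP a b; last first.
  by rewrite big_geq// (_ : (_ - _)%N = 0%N)//; lia.
rewrite big_nat_recr//= IH; case: ifP => h; last by rewrite addr0; congr (_ *+ _); lia.
by rewrite -mulrSr; congr (_ *+ _); lia.
Qed.

Section GapInstance.
Variables (p : nat) (p_gt0 : (0 < p)%N).

(* [p] consecutive groups of [p * p.+1] jobs; each group consists of [p] layers
   with a single job, followed by one layer with [p * p] jobs. *)
Definition gap_lev (j : nat) : nat :=
  (j %/ (p * p.+1) * p.+1 + minn (j %% (p * p.+1)) p)%N.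

Definition gap_prec : rel 'I_(p * (p * p.+1)) :=
  fun i j => (gap_lev i < gap_lev j)%N.

Lemma gap_prec_irr : irreflexive gap_prec.
Proof. by move=> i; rewrite /gap_prec ltnn. Qed.

Lemma gap_prec_trans : transitive gap_prec.
Proof. by move=> j i k; exact: ltn_trans. Qed.

Definition gap_instance : instance := Instance p_gt0 gap_prec_irr gap_prec_trans.

Let group_gt0 : (0 < p * p.+1)%N. Proof. by rewrite muln_gt0 p_gt0. Qed.

Lemma gap_lev_group (g r : nat) : (r < p * p.+1)%N ->
  gap_lev (g * (p * p.+1) + r) = (g * p.+1 + minn r p)%N.
Proof.
by move=> rq; rewrite /gap_lev divnMDl// modnMDl divn_small// modn_small// addn0.
Qed.

Lemma gap_lev_lt (j : 'I_(p * (p * p.+1))) : (gap_lev j < p * p.+1)%N.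
Proof.
have : (j %/ (p * p.+1) < p)%N by rewrite ltn_divLR.
rewrite /gap_lev => jp; apply: (@leq_trans ((j %/ (p * p.+1)).+1 * p.+1)).
  by rewrite mulSn addnC ltn_add2r ltnS geq_minr.
by rewrite leq_mul2r jp orbT.
Qed.

Lemma gap_job_lt (g r : nat) : (g < p)%N -> (r < p * p.+1)%N ->
  (g * (p * p.+1) + r < p * (p * p.+1))%N.
Proof.
move=> gp rq; apply: (@leq_trans (g.+1 * (p * p.+1))).
  by rewrite mulSn addnC ltn_add2r.
by rewrite leq_mul2r gp orbT.
Qed.

Lemma gap_big_layer (g : nat) : (g < p)%N ->
  (p * p <= #|[pred j : 'I_(p * (p * p.+1)) | gap_lev j == g * p.+1 + p]|)%N.
Proof.
move=> gp; have rq (i : 'I_(p * p)) : (p + i < p * p.+1)%N.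
  by rewrite mulnS ltn_add2l.
pose f i := Ordinal (gap_job_lt gp (rq i)).
have f_inj : injective f by move=> i j [] /addnI /addnI /val_inj.
rewrite -[X in (X <= _)%N]card_ord -(card_codom f_inj).
apply: subset_leq_card; apply/fintype.subsetP => _ /codomP[i ->].
by rewrite inE /= gap_lev_group// (minn_idPr (leq_addr _ _)).
Qed.

(* Jobs in [p.+1] consecutive layers are determined by their position in
   their group. *)
Lemma gap_window (t : nat) :
  (#|[pred j : 'I_(p * (p * p.+1)) | gap_lev j < t <= gap_lev j + p.+1]|
    <= p * p.+1)%N.
Proof.
rewrite -[X in (_ <= X)%N]card_ord.
apply: (@leq_card_in _ _ (fun j : 'I_(p * (p * p.+1)) => Ordinal (ltn_pmod j group_gt0))).
move=> i j; rewrite !inE => ti tj [eqr]; apply: val_inj => /=.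
rewrite (divn_eq i (p * p.+1)) (divn_eq j (p * p.+1)) eqr; congr (_ * _ + _)%N.
(* Equal positions make the two levels differ by a multiple of [p.+1], yet both lie among the [p.+1]
   values from [t - p.+1] to [t - 1]. *)
by move: ti tj; rewrite /gap_lev eqr; nia.
Qed.

Lemma gap_OPT_ge (R : realType) : (2 * p * p)%:R <= OPT R gap_instance.
Proof.
apply: OPT_ge => s fs.
pose lev (j : 'I_(njobs gap_instance)) := gap_lev j.
have lev_prec i j : (lev i < lev j)%N -> prec i j by [].
have need_single g r : (g < p)%N -> (r <= p)%N ->
    layers_need (s := s) lev (g * p.+1) (2 * p * g)%:R ->
    layers_need (s := s) lev (g * p.+1 + r) (2 * p * g + r)%:R.
  move=> gp + need0; elim: r => [|r IH] rp; first by rewrite !addn0.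
  have rq : (r < p * p.+1)%N by apply: leq_trans rp _; rewrite leq_pmulr.
  rewrite !addnS -natr1.
  apply: (layers_need_job fs lev_prec (j := Ordinal (gap_job_lt gp rq))).
    by rewrite /lev /= gap_lev_group// (minn_idPl (ltnW rp)).
  exact/IH/ltnW.
have need_groups g : (g <= p)%N ->
    layers_need (s := s) lev (g * p.+1) (2 * p * g)%:R.
  elim: g => [_|g IH gp]; first by rewrite muln0 => B B0.
  (* After the [p] single jobs of group [g], its [p * p] jobs on [p] machines take another [p] time
     units. *)
  have := layers_need_volume fs lev_prec (gap_big_layer gp)
    (need_single g p gp (leqnn p) (IH (ltnW gp))).
  rewrite -natrD -addnS -mulSnr; congr (layers_need _ _ _%:R); lia.
by apply: (need_groups p (leqnn p)) => [|i _]; [exact: makespan_ge0|exact: pend_le_makespan].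
Qed.

(* Every job is spread evenly over the [p.+1] time steps following the index of
   its layer. *)
Lemma gap_LP_feasible (R : realType) :
  LP_feasible R gap_instance (p * p.+1 + p).
Proof.
exists (fun j t => if (gap_lev j < t <= gap_lev j + p.+1)%N then p.+1%:R^-1 else 0).
have p1 : 0 < p.+1%:R :> R by rewrite ltr0n.
have lev_lt (j : 'I_(njobs gap_instance)) : (gap_lev j < p * p.+1)%N := gap_lev_lt j.
split=> [t _|j|l k lk t' /andP[t'0 t'T]|j t _].
- rewrite -big_mkcond/= sumr_const -[leLHS]mulr_natl ler_pdivrMr// -natrM ler_nat.
  exact: gap_window.
- rewrite sum_nat_window.
  have -> : (minn (p * p.+1 + p).+1 (gap_lev j + p.+1).+1 - maxn 1 (gap_lev j).+1 = p.+1)%N.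
    (* The last level is [p * p.+1 - 1], so its window ends exactly at the horizon. *)
    by have := lev_lt j; lia.
  by rewrite -[LHS]mulr_natl divff// gt_eqF.
- rewrite !sum_nat_window -mulrnDr -[leRHS]mulr_natl ler_pdivlMr// mul1r ler_nat.
  (* The window of [k] starts at least one step after that of [l], so the steps of [l] before [t']
     and those of [k] after [t'] number at least [p.+1]. *)
  by have := lev_lt k; have : (gap_lev l < gap_lev k)%N := lk; lia.
- by case: ifP => // _; rewrite invr_ge0 ltW.
Qed.

Lemma gap_T_LP_le (R : realType) : (T_LP R gap_instance <= p * p.+1 + p)%N.
Proof.
rewrite /T_LP; case: ex_minnP => T _; apply.
by rewrite addn_gt0 p_gt0 orbT /=; apply/asboolP; exact: gap_LP_feasible.
Qed.

Lemma gap_ratio (R : realType) :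
  2 - 4 / (p + 2)%:R <= OPT R gap_instance / (T_LP R gap_instance)%:R.
Proof.
have T0 : 0 < (T_LP R gap_instance)%:R :> R. by rewrite ltr0n T_LP_gt0.
have T_le : (T_LP R gap_instance)%:R <= (p * (p + 2))%:R :> R.
  by rewrite ler_nat; have := gap_T_LP_le R; lia.
have p2 : 0 < (p + 2)%:R :> R by rewrite ltr0n addn2.
have -> : 2 - 4 / (p + 2)%:R = 2 * p%:R / (p + 2)%:R :> R.
  apply/eqP; rewrite subr_eq -mulrDl eq_sym; apply/eqP/(canLR (mulfK _)).
    by rewrite gt_eqF.
  by rewrite natrD; lra.
rewrite ler_pdivlMr//; apply: le_trans (gap_OPT_ge R).
rewrite mulrAC ler_pdivrMr// !natrM -!mulrA ler_wpM2l// ler_wpM2l//.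
by rewrite -natrM.
Qed.

End GapInstance.

(** * The supremum equals 2 *)

Local Open Scope classical_set_scope.

Theorem theorem11 (R : realType) :
  ereal_sup [set (OPT R I / (T_LP R I)%:R)%:E | I in [set: instance]] = 2%:E.
Proof.
apply/eqP; rewrite eq_le; apply/andP; split.
  apply: ge_ereal_sup => _ [I _ <-]; rewrite lee_fin ler_pdivrMr ?OPT_le_2T_LP//.
  by rewrite ltr0n T_LP_gt0.
(* Choosing [p > 4 / e] brings the deficit [4 / (p + 2)] of the gap instance below [e]. *)
apply/lee_addgt0Pr => e e0; pose p := Num.bound (4 / e).
have p_lt : 4 / e < p%:R by apply: archi_boundP; rewrite divr_ge0// ltW.
have p_gt0 : (0 < p)%N by rewrite -(ltr0n R) (le_lt_trans _ p_lt)// divr_ge0// ltW.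
have small : 4 / (p + 2)%:R <= e.
  rewrite ler_pdivrMr ?ltr0n ?addn2// mulrC -ler_pdivrMr//.
  by rewrite (le_trans (ltW p_lt))// ler_nat leqW.
apply: (@le_trans _ _ ((OPT R (gap_instance p_gt0) / (T_LP R (gap_instance p_gt0))%:R)%:E + e%:E)%E).
  by rewrite -EFinD lee_fin; have := gap_ratio p_gt0 R; lra.
by apply: leeD2r; apply: ereal_sup_ubound; exists (gap_instance p_gt0).
Qed.
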